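(* Let $n>k\geq1$, $r=n-k$, and let $2\leq h\leq n-k$ and $k<d\leq n-h$ be integers. Let $\delta=\gcd(h,d-k)$, $s_0=\frac{d-k+\delta}{\delta}$, $s=\frac{d-k+h}{\delta}$ and $\ell=s\cdot s_0^n$. Let $F$ be a finite field with $|F|\geq s_0 n$ and let $\lambda_{i,j}$, $i\in[n]$, $j\in[0,s_0-1]$, be $s_0 n$ distinct elements of $F$. Let $\mathcal{C}_3$ be the set of all $(\bm c_1,\ldots,\bm c_n)$ with $\bm c_i=(c_{i,0},\ldots,c_{i,\ell-1})\in F^\ell$ satisfying $$\sum_{i=1}^n \lambda_{i,a_i}^{t-1} c_{i,(a,b)}=0\quad\text{for all } a\in[0,s_0^n-1],\ b\in[0,s-1],\ t\in[r].$$ Then $\mathcal{C}_3$ is an $(n,k,\ell)$ MDS array code satisfying the $(h,d)$-optimal repair property.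
   Context: Notation: $[n]=\{1,\ldots,n\}$, $[i,j]=\{i,\ldots,j\}$. Each $\tau\in[0,\ell-1]$ is written uniquely as $\tau=b\cdot s_0^n+\sum_{i=1}^n a_i s_0^{i-1}$ with $b\in[0,s-1]$, $a_i\in[0,s_0-1]$; we write $a=(a_1,\ldots,a_n)=\sum_i a_i s_0^{i-1}$ and $\tau=(a,b)$, so $c_{i,(a,b)}=c_{i,\tau}$. An $(n,k,\ell)$ MDS array code over $F$ is an $F$-linear set of vectors $(\bm c_1,\ldots,\bm c_n)$, $\bm c_i\in F^\ell$ (node $i$ stores $\bm c_i$), of dimension $k\ell$, such that any $k$ coordinates $\bm c_i$ determine the codeword. The $(h,d)$-optimal repair property means: for every $h$-subset $\mathcal{H}\subseteq[n]$ and every $d$-subset $\mathcal{R}\subseteq[n]\setminus\mathcal{H}$, each helper $j\in\mathcal{R}$ can send $\beta=\frac{h\ell}{d-k+h}$ symbols of $F$ computed from $\bm c_j$ such that from these $\frac{dh\ell}{d-k+h}$ symbols in total all $\bm c_i$, $i\in\mathcal{H}$, are determined, for every codeword (equality in the cut-set bound). *)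

(* Defs.v *)
From HB Require Import structures.
From mathcomp Require Import all_boot all_order all_algebra.
Unset Implicit Arguments. Unset Printing Implicit Defensive.
Import Order.TTheory GRing.Theory Num.Theory.
Local Open Scope ring_scope.

Definition delta (k h d : nat) : nat := gcdn h (d - k).
Definition s0 (k h d : nat) : nat := ((d - k + delta k h d) %/ delta k h d)%N.
Definition sp (k h d : nat) : nat := ((d - k + h) %/ delta k h d)%N.
Definition ell (n k h d : nat) : nat := (sp k h d * s0 k h d ^ n)%N.

(* An (n,k,l) MDS array code: codewords are n x l matrices over F, row i
   being the vector c_i stored by node i.  The code is the set of matrices
   satisfying P; it must be an F-linear subspace of dimension k*l such that
   any k rows determine the codeword. *)
Definition is_MDS_array_code (F : fieldType) (n k l : nat)
    (P : 'M[F]_(n, l) -> Prop) : Prop :=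
  exists U : {vspace 'M[F]_(n, l)},
    (forall C, C \in U <-> P C) /\
    \dim U = (k * l)%N /\
    (forall K : {set 'I_n}, #|K| = k ->
       forall C C', P C -> P C' ->
         (forall i, i \in K -> row i C = row i C') -> C = C').

(* (h,d)-optimal repair: for every h-set H of failed nodes and every d-set R
   of helpers disjoint from H, each helper j in R sends
   beta = h*l/(d-k+h) symbols g j (c_j), and from these all c_i (i in H)
   are recovered, for every codeword. *)
Definition optimal_repair (F : fieldType) (n k l h d : nat)
    (P : 'M[F]_(n, l) -> Prop) : Prop :=
  let beta := ((h * l) %/ (d - k + h))%N in
  forall H R : {set 'I_n}, #|H| = h -> #|R| = d -> [disjoint H & R] ->
    exists (g : 'I_n -> 'rV[F]_l -> 'rV[F]_beta)
           (rec : ('I_n -> 'rV[F]_beta) -> 'I_n -> 'rV[F]_l),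
      forall C, P C ->
        forall i, i \in H ->
          rec (fun j => if j \in R then g j (row j C) else 0) i = row i C.

Lemma tau_subproof (m p : nat) (a : 'I_m) (b : 'I_p) : (b * m + a < p * m)%N.
Proof.
case: b => b /= Hb; case: a => a /= Ha.
apply: (@leq_trans (b * m + m)%N); first by rewrite ltn_add2l.
by rewrite -[X in (_ + X)%N]mul1n -mulnDl addn1 leq_mul2r Hb orbT.
Qed.

Definition tau_idx (m p : nat) (a : 'I_m) (b : 'I_p) : 'I_(p * m) :=
  Ordinal (@tau_subproof m p a b).

(* The code C_3.  The index tau = (a,b) = b*s0^n + a is tau_idx a b,
   and the digit a_i (0-based i) is (a / s0^i) mod s0. *)
Definition inC3 (F : fieldType) (n k h d : nat) (lam : 'I_n -> nat -> F)
    (C : 'M[F]_(n, ell n k h d)) : Prop :=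
  forall (a : 'I_(s0 k h d ^ n)) (b : 'I_(sp k h d)) (t : nat),
    (1 <= t <= n - k)%N ->
    \sum_(i < n) lam i ((a %/ s0 k h d ^ i) %% s0 k h d)%N ^+ (t - 1)
        * C i (@tau_idx (s0 k h d ^ n) (sp k h d) a b) = 0.

(* Main.v *)
(** Write h = h' q and d - k = m q with q = gcd(h, d - k); then s0 = m + 1 and
    s = m + h', and the failed nodes split into h' groups of q nodes.  For every
    group G and every a, helpers send the sum of their symbols over the m + 1
    positions (a + u 1_G, u), u < m, and (a + m 1_G, m + g), where g is the index
    of G and digits are added mod s0.  Adding the parity checks at these positions
    yields r equations of Vandermonde type: each node of G contributes s0 separate
    unknowns, as its digit takes all values, and each other node contributes only
    its sum.  Once the d helper sums are known, q s0 + (n - q - d) = r unknowns are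
    left and all are determined.  This gives the blocks u < m of every failed node,
    and then the sums computed for the other groups give its remaining blocks. *)

Require Import Defs.
From HB Require Import structures.
From mathcomp Require Import all_boot all_order all_algebra.
Import GRing.Theory.
Set Implicit Arguments. Unset Strict Implicit. Unset Printing Implicit Defensive.
Local Open Scope ring_scope.

(** * Vandermonde systems and the MDS property *)

(** Combining the equations with the coefficients of the product of the X - x_j, j ≠ i, a polynomial
    of degree below r, leaves only p(x_i) y_i, and p(x_i) is nonzero. *)
Lemma power_sums_eq0 (F : fieldType) (I : finType) (A : {set I})
    (x y : I -> F) (r : nat) :
  (#|A| <= r)%N -> {in A &, injective x} ->
  (forall t, (t < r)%N -> \sum_(i in A) x i ^+ t * y i = 0) ->
  {in A, forall i, y i = 0}.
Proof.
move=> leAr injx sum0 i iA.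
pose p := \prod_(j in A :\ i) ('X - (x j)%:P).
have sp : (size p <= r)%N.
  rewrite /p -big_enum /= size_prod_XsubC -cardE; apply: leq_trans leAr.
  by rewrite (cardsD1 i A) iA.
have: \sum_(j in A) p.[x j] * y j = 0.
  under eq_bigr => j _ do rewrite (horner_coef_wide _ sp) mulr_suml.
  rewrite exchange_big /= big1 // => t _.
  under eq_bigr => j _ do rewrite -mulrA.
  by rewrite -mulr_sumr sum0 ?mulr0.
rewrite (bigD1 i) //= big1 => [|j /andP[jA ji]]; last first.
  rewrite /p horner_prod (bigD1 j) ?inE ?ji //=.
  by rewrite hornerXsubC subrr !mul0r.
rewrite addr0 => /eqP; rewrite mulf_eq0 => /orP[|/eqP //].
rewrite /p horner_prod => /prodf_eq0[j]; rewrite !inE => /andP[ji jA].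
by rewrite hornerXsubC subr_eq0 => /eqP /(injx _ _ iA jA) ij; rewrite ij eqxx in ji.
Qed.

Definition vandermonde_code (F : fieldType) (n r l : nat) (x : 'I_n -> 'I_l -> F)
    (C : 'M[F]_(n, l)) : Prop :=
  forall (tau : 'I_l) (t : nat), (t < r)%N ->
    \sum_(i < n) x i tau ^+ t * C i tau = 0.

(** In each column the n - k entries outside K solve a Vandermonde system of n - k equations. *)
Lemma vandermonde_code_eq0 (F : fieldType) (n k l : nat) (x : 'I_n -> 'I_l -> F)
    (K : {set 'I_n}) (C : 'M[F]_(n, l)) :
  (forall tau, injective (x^~ tau)) -> #|K| = k ->
  vandermonde_code (n - k) x C -> (forall i, i \in K -> row i C = 0) -> C = 0.
Proof.
move=> injx cardK codeC C0; apply/matrixP=> i tau; rewrite mxE.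
have C0' j : j \in K -> C j tau = 0.
  by move=> /C0 /rowP /(_ tau); rewrite !mxE.
have [/C0' //|iK] := boolP (i \in K).
apply: (@power_sums_eq0 _ _ (~: K) (x^~ tau) (C^~ tau) (n - k)).
- by rewrite cardsCs setCK card_ord cardK.
- by move=> ? ? _ _ /injx.
- move=> t tr; rewrite -[RHS](codeC tau t tr) [RHS](bigID (mem K)) /=.
  rewrite [X in _ = X + _]big1 ?add0r => [|j /C0' ->]; last by rewrite mulr0.
  by apply: eq_bigl => j; rewrite !inE.
- by rewrite inE.
Qed.

(** The parity-check map: the code is its kernel, so rank-nullity applies. *)
Definition syndrome (F : fieldType) (n r l : nat) (x : 'I_n -> 'I_l -> F)
    (C : 'M[F]_(n, l)) : 'M[F]_(r, l) :=
  \matrix_(t, tau) \sum_(i < n) x i tau ^+ t * C i tau.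

Lemma syndrome_is_linear (F : fieldType) (n r l : nat) (x : 'I_n -> 'I_l -> F) :
  linear (@syndrome F n r l x).
Proof.
move=> a C D; apply/matrixP=> t tau; rewrite !mxE mulr_sumr -big_split /=.
by apply: eq_bigr => i _; rewrite !mxE mulrDr mulrCA.
Qed.

HB.instance Definition _ (F : fieldType) (n r l : nat) (x : 'I_n -> 'I_l -> F) :=
  GRing.isLinear.Build F 'M[F]_(n, l) 'M[F]_(r, l) _ (@syndrome F n r l x)
    (@syndrome_is_linear F n r l x).

Lemma vandermonde_codeP (F : fieldType) (n r l : nat) (x : 'I_n -> 'I_l -> F) C :
  C \in lker (linfun (@syndrome F n r l x)) <-> vandermonde_code r x C.
Proof.
rewrite memv_ker lfunE; split=> [/eqP/matrixP C0 tau t tr | C0].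
  by have := C0 (Ordinal tr) tau; rewrite !mxE.
by apply/eqP/matrixP=> t tau; rewrite !mxE C0.
Qed.

Lemma vandermonde_code_MDS (F : fieldType) (n k l : nat) (x : 'I_n -> 'I_l -> F) :
  (k <= n)%N -> (forall tau, injective (x^~ tau)) ->
  is_MDS_array_code F n k l (vandermonde_code (n - k) x).
Proof.
move=> le_kn injx; pose f := linfun (@syndrome F n (n - k) l x).
have inU C : C \in lker f <-> vandermonde_code (n - k) x C.
  exact: vandermonde_codeP.
exists (lker f); split=> //; split; last first.
  move=> K cardK C D /inU CU /inU DU eqCD; apply/eqP; rewrite -subr_eq0; apply/eqP.
  apply: (vandermonde_code_eq0 injx cardK); first exact/inU/memvB.
  by move=> i /eqCD; rewrite linearB /= => ->; rewrite subrr.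
apply/eqP; rewrite eqn_leq; apply/andP; split.
  (* Upper bound: projection to the first k rows is injective on the code. *)
  pose p := linfun (rowsub (widen_ord le_kn) : 'M[F]_(n, l) -> 'M[F]_(k, l)).
  have inj_p : (lker f :&: lker p = 0)%VS.
    apply/eqP; rewrite -subv0; apply/subvP => C; rewrite memv_cap memv0.
    move=> /andP[/inU CU]; rewrite memv_ker lfunE /= => /eqP/row_matrixP pC0.
    apply/eqP; apply: (vandermonde_code_eq0 (K := widen_ord le_kn @: setT) injx _ CU).
      rewrite card_imset ?cardsT ?card_ord // => i j /(congr1 val) ij.
      exact: val_inj.
    by move=> _ /imsetP[j _ ->]; have := pC0 j; rewrite row_rowsub row0.
  rewrite -(limg_dim_eq inj_p); apply: leq_trans (dimvS (subvf _)) _.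
  by rewrite dimvf /dim /=.
(* Lower bound: the syndrome takes values in dimension (n - k) l. *)
have := limg_ker_dim f fullv; rewrite capfv dimvf /dim /= => dimf.
have : (\dim (f @: fullv) <= (n - k) * l)%N.
  by apply: leq_trans (dimvS (subvf _)) _; rewrite dimvf /dim /=.
rewrite -(leq_add2l (\dim (lker f))) dimf => le_dim.
by rewrite -(leq_add2r ((n - k) * l)) -mulnDl subnKC.
Qed.

(** * Repair of one group, then of all groups *)

(** Addition in ['I_m.+1] wraps modulo m + 1, so a digit in G takes each value once as u varies. *)
Definition shift (T : finType) (m : nat) (G : {set T}) (u : 'I_m.+1)
    (a : {ffun T -> 'I_m.+1}) : {ffun T -> 'I_m.+1} :=
  [ffun i => if i \in G then a i + u else a i].

Lemma shiftNK (T : finType) (m : nat) (G : {set T}) (u : 'I_m.+1) :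
  cancel (shift G (- u)) (shift G u).
Proof. by move=> a; apply/ffunP=> i; rewrite !ffunE; case: ifP => iG; rewrite iG ?subrK. Qed.

(** [w u i a] is the symbol of node i at position a in the block paired with u; Z is the set of
    non-helpers. The homogeneous form suffices, since differences of codewords are codewords. *)
Lemma group_repair (F : fieldType) (T : finType) (m r : nat)
    (lam : T -> 'I_m.+1 -> F) (G Z : {set T})
    (w : 'I_m.+1 -> T -> {ffun T -> 'I_m.+1} -> F) :
  (forall i i' j j', lam i j = lam i' j' -> i = i' /\ j = j') ->
  G \subset Z -> (#|G| * m + #|Z| <= r)%N ->
  (forall u (a : {ffun T -> 'I_m.+1}) t, (t < r)%N -> \sum_i lam i (a i) ^+ t * w u i a = 0) ->
  (forall i a, i \notin Z -> \sum_u w u i (shift G u a) = 0) ->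
  (forall i u a, i \in G -> w u i a = 0) /\
  (forall i a, i \notin G -> \sum_u w u i (shift G u a) = 0).
Proof.
move=> inj_lam sGZ le_r parity helper.
(* One index per unknown: (i, u) for i in G, and a single sum, tagged [ord0], for each other node of
   Z. *)
pose A := setX G [set: 'I_m.+1] :|: setX (Z :\: G) [set ord0].
have cardA : (#|A| <= r)%N.
  apply: leq_trans le_r; rewrite (leq_trans (leq_card_setU _ _)) //.
  rewrite !cardsX cardsT card_ord cards1 muln1 mulnS.
  by rewrite [X in (X + _)%N]addnC -addnA leq_add2l addnC cardsD (setIidPr sGZ) subnK // subset_leq_card.
pose y a (z : T * 'I_m.+1) :=
  if z.1 \in G then w z.2 z.1 (shift G z.2 a) else \sum_u w u z.1 (shift G u a).
have y0 a : {in A, forall z, y a z = 0}.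
  apply: (@power_sums_eq0 _ _ A (fun z => lam z.1 (shift G z.2 a z.1)) _ r) => //.
    move=> [i u] [j v]; rewrite !inE /= !ffunE.
    move=> Ai Aj /inj_lam[ij]; subst j; move: Ai Aj; case: (i \in G) => /=.
      by move=> _ _ /addrI ->.
    by move=> /andP[_ /eqP ->] /andP[_ /eqP ->].
  move=> t tr; transitivity (\sum_(i in Z) \sum_(u | (i, u) \in A)
      lam i (shift G u a i) ^+ t * y a (i, u)).
    rewrite pair_big_dep /=; apply: eq_big => [[i u]|[i u] _] //; rewrite !inE /= andbT.
    by case: (boolP (i \in G)) => [/(subsetP sGZ) ->|_] //=; rewrite andbA andbb.
  (* Outside G the shift fixes the digit, so the power factors out of the sum over u; outside Z that
     sum vanishes. What results is a sum of m + 1 parity checks. *)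
  transitivity (\sum_i \sum_u lam i (shift G u a i) ^+ t * w u i (shift G u a)).
    rewrite [RHS](bigID (mem Z)) /= [X in _ = _ + X]big1 ?addr0 => [|i iZ].
      apply: eq_bigr => i iZ; have [iG|iG] := boolP (i \in G).
        by apply: eq_big => [u|u _]; rewrite ?inE /y /= iG.
      rewrite (big_pred1 ord0) => [|u]; last by rewrite !inE /= (negbTE iG) iZ.
      rewrite /y /= (negbTE iG) mulr_sumr; apply: eq_bigr => u _.
      by rewrite !ffunE (negbTE iG).
    have iG : i \notin G by apply: contra iZ; apply: (subsetP sGZ).
    transitivity (lam i (a i) ^+ t * \sum_u w u i (shift G u a)).
      by rewrite mulr_sumr; apply: eq_bigr => u _; rewrite ffunE (negbTE iG).
    by rewrite helper ?mulr0.
  by rewrite exchange_big big1 // => u _; apply: parity.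
split=> [i u a iG|i a iG].
  have := y0 (shift G (- u) a) (i, u); rewrite /y /= iG shiftNK; apply.
  by rewrite !inE /= iG.
have [iZ|/helper //] := boolP (i \in Z).
have := y0 a (i, ord0); rewrite /y /= (negbTE iG); apply.
by rewrite !inE /= (negbTE iG) iZ.
Qed.

(** The last value of u selects the block private to group g, the others the m shared blocks. *)
Definition block (m h : nat) (g : 'I_h) (u : 'I_m.+1) : 'I_m + 'I_h :=
  if unlift ord_max u is Some v then inl v else inr g.

Lemma centralized_repair (F : fieldType) (T : finType) (m r h : nat)
    (lam : T -> 'I_m.+1 -> F) (G : 'I_h -> {set T}) (Z : {set T})
    (c : T -> {ffun T -> 'I_m.+1} -> 'I_m + 'I_h -> F) :
  (forall i i' j j', lam i j = lam i' j' -> i = i' /\ j = j') ->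
  (forall g, G g \subset Z) -> (forall g, #|G g| * m + #|Z| <= r)%N ->
  (forall (a : {ffun T -> 'I_m.+1}) b t, (t < r)%N -> \sum_i lam i (a i) ^+ t * c i a b = 0) ->
  (forall i g a, i \notin Z ->
     \sum_u c i (shift (G g) u a) (block g u) = 0) ->
  forall i g a b, i \in G g -> c i a b = 0.
Proof.
move=> inj_lam sGZ le_r parity helper i g a b iG.
have [repG sumG] : (forall g' i' u a', i' \in G g' -> c i' a' (block g' u) = 0) /\
    (forall g' i' a', i' \notin G g' ->
       \sum_u c i' (shift (G g') u a') (block g' u) = 0).
  by split=> g'; have [] := @group_repair _ _ _ _ lam (G g') Z
    (fun u i a => c i a (block g' u)) inj_lam (sGZ g') (le_r g')
    (fun u a => parity a _) (fun i => helper i g').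
have inl0 v a' : c i a' (inl v) = 0.
  by have := repG g i (lift ord_max v) a' iG; rewrite /block liftK.
case: b => [v|g']; first exact: inl0.
have block_max : block g' ord_max = inr g' :> 'I_m + 'I_h by rewrite /block unlift_none.
have [iG'|iG'] := boolP (i \in G g').
  by rewrite -block_max repG.
(* In this sum the shared blocks of i are already zero, so its block private to g' vanishes; the
   shift by [- ord_max] makes that term fall at a. *)
have := sumG g' i (shift (G g') (- ord_max) a) iG'.
rewrite (bigD1 ord_max) //= big1 ?addr0 => [|u]; first by rewrite shiftNK block_max.
by rewrite eq_sym /block => /unlift_some[v _ ->].
Qed.

(** * Digit vectors and the index tau *)

Lemma digits_inj (p n a a' : nat) : (0 < p)%N -> (a < p ^ n)%N -> (a' < p ^ n)%N ->
  (forall i, (i < n)%N -> (a %/ p ^ i) %% p = (a' %/ p ^ i) %% p)%N -> a = a'.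
Proof.
move=> p0; elim: n a a' => [|n IH] a a'; first by rewrite !ltnS !leqn0 => /eqP-> /eqP->.
move=> la la' eqd; rewrite (divn_eq a p) (divn_eq a' p).
have := eqd 0%N isT; rewrite expn0 !divn1 => ->; congr (_ * _ + _)%N.
apply: IH; rewrite ?ltn_divLR -?expnSr // => i lt_in.
by have := eqd i.+1 lt_in; rewrite expnS !divnMA.
Qed.

Definition digits (m n : nat) (a : 'I_(m.+1 ^ n)) : {ffun 'I_n -> 'I_m.+1} :=
  [ffun i : 'I_n => inord ((a %/ m.+1 ^ i) %% m.+1)].

Lemma digitsE (m n : nat) (a : 'I_(m.+1 ^ n)) i :
  digits a i = ((a %/ m.+1 ^ i) %% m.+1)%N :> nat.
Proof. by rewrite ffunE inordK // ltn_pmod. Qed.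

Lemma digits_bij (m n : nat) : bijective (@digits m n).
Proof.
apply: inj_card_bij; last by rewrite card_ffun !card_ord.
move=> a a' eqa; apply: val_inj; apply: (@digits_inj m.+1 n _ _ isT (ltn_ord a) (ltn_ord a')) => i lt_in.
by rewrite -!(digitsE _ (Ordinal lt_in)) eqa.
Qed.

Lemma tau_idx_surj (N s : nat) (tau : 'I_(s * N)) :
  exists a b, tau = tau_idx N s a b.
Proof.
have N0 : (0 < N)%N.
  by case: N tau => // -[t]; rewrite muln0.
have la : (tau %% N < N)%N by rewrite ltn_pmod.
have lb : (tau %/ N < s)%N by rewrite ltn_divLR.
by exists (Ordinal la), (Ordinal lb); apply/val_inj; rewrite /= -divn_eq.
Qed.

(** [inC3] with free parameters p, s, r, so that m + 1 and m + h' can be put for s0 and s. *)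
Definition digit_code (F : fieldType) (n r p s : nat) (lam : 'I_n -> nat -> F)
    (C : 'M[F]_(n, s * p ^ n)) : Prop :=
  forall (a : 'I_(p ^ n)) (b : 'I_s) (t : nat), (1 <= t <= r)%N ->
    \sum_(i < n) lam i ((a %/ p ^ i) %% p)%N ^+ (t - 1)
      * C i (tau_idx (p ^ n) s a b) = 0.

Lemma digit_codeE (F : fieldType) (n r p s : nat) (lam : 'I_n -> nat -> F) C :
  @digit_code F n r p s lam C <->
  vandermonde_code r
    (fun i tau => lam i ((tau %% p ^ n %/ p ^ i) %% p)%N) C.
Proof.
have modE a b : (tau_idx (p ^ n) s a b %% p ^ n)%N = a by rewrite /= modnMDl modn_small.
split=> codeC.
  move=> tau t tr; have [a [b ->]] := tau_idx_surj tau.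
  by rewrite -[RHS](codeC a b t.+1) // modE subn1.
move=> a b [//|t] /= tr; rewrite -[RHS](codeC (tau_idx _ _ a b) t tr).
by rewrite modE subn1.
Qed.

Lemma digit_code_MDS (F : fieldType) (n k p s : nat) (lam : 'I_n -> nat -> F) :
  (0 < p)%N -> (k <= n)%N ->
  (forall (i i' : 'I_n) (j j' : nat), (j < p)%N -> (j' < p)%N ->
     lam i j = lam i' j' -> i = i' /\ j = j') ->
  is_MDS_array_code F n k (s * p ^ n) (@digit_code F n (n - k) p s lam).
Proof.
move=> p0 le_kn inj_lam.
have [|U [inU [dimU detU]]] := @vandermonde_code_MDS F n k (s * p ^ n)
  (fun i tau => lam i ((tau %% p ^ n %/ p ^ i) %% p)%N) le_kn.
  by move=> tau i i' /inj_lam[]; rewrite ?ltn_pmod.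
exists U; split; first by move=> C; exact: iff_trans (inU C) (iff_sym (digit_codeE _ _ _)).
by split=> // K cardK C D /digit_codeE CP /digit_codeE DP; apply: detU.
Qed.

(* Over a finite field the decoder may search for a codeword consistent with
   the received symbols, so it suffices that the messages separate the failed rows. *)
Lemma linear_repair (F : finFieldType) (n l beta : nat)
    (U : {vspace 'M[F]_(n, l)}) (H R : {set 'I_n})
    (g : {linear 'rV[F]_l -> 'rV[F]_beta}) :
  (forall C, C \in U -> (forall j, j \in R -> g (row j C) = 0) ->
     forall i, i \in H -> row i C = 0) ->
  exists rec : ('I_n -> 'rV[F]_beta) -> 'I_n -> 'rV[F]_l,
    forall C, C \in U -> forall i, i \in H ->
      rec (fun j => if j \in R then g (row j C) else 0) i = row i C.
Proof.
move=> sep.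
pose rec (msg : 'I_n -> 'rV[F]_beta) i :=
  if [pick C : 'M[F]_(n, l) |
      (C \in U) && [forall (j | j \in R), g (row j C) == msg j]] is Some C
  then row i C else 0.
exists rec => C CU i iH; rewrite /rec; case: pickP => [D /andP[DU /forall_inP eqD]|none].
  apply/eqP; rewrite -subr_eq0 -linearB; apply/eqP/sep => //; first exact: memvB.
  by move=> j jR; have := eqD j jR; rewrite jR !linearB /= => /eqP ->; rewrite subrr.
have /negP[] := negbT (none C); rewrite CU /=.
by apply/forall_inP => j jR; rewrite jR.
Qed.

(** * Groups, helper messages and repair of the digit code *)

Lemma set_split (T : finType) (H : {set T}) (h q : nat) : #|H| = (h * q)%N ->
  exists G : 'I_h -> {set T}, [/\ forall g, G g \subset H, forall g, #|G g| = q &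
    forall i, i \in H -> exists g, i \in G g].
Proof.
move=> cardH.
have cardP : #|{: 'I_h * 'I_q}| = #|H| by rewrite card_prod !card_ord cardH.
(* [e] enumerates H by pairs (group, place in the group). *)
pose e x := enum_val (cast_ord cardP (enum_rank x)).
have inj_e : injective e by move=> x y /enum_val_inj /cast_ord_inj /enum_rank_inj.
exists (fun g => [set e (g, v) | v : 'I_q]); split=> [g|g|i iH].
- by apply/subsetP=> _ /imsetP[v _ ->]; apply: enum_valP.
- by rewrite card_imset ?card_ord // => v v' /inj_e[].
- pose x := enum_val (cast_ord (esym cardP) (enum_rank_in iH i)).
  exists x.1; apply/imsetP; exists x.2 => //.
  by rewrite -surjective_pairing /e enum_valK cast_ordKV enum_rankK_in.
Qed.

(** [I] is the type of queries, later the pairs (group index, digit vector). *)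
Definition helper_message (F : fieldType) (l N : nat) (I : Type)
    (q : 'I_N -> I) (m : nat) (idx : I -> 'I_m -> 'I_l) (v : 'rV[F]_l) : 'rV[F]_N :=
  \row_x \sum_u v 0 (idx (q x) u).

Lemma helper_message_is_linear (F : fieldType) (l N : nat) (I : Type)
    (q : 'I_N -> I) (m : nat) (idx : I -> 'I_m -> 'I_l) :
  linear (@helper_message F l N I q m idx).
Proof.
move=> a v w; apply/rowP=> x; rewrite !mxE mulr_sumr -big_split /=.
by apply: eq_bigr => u _; rewrite !mxE.
Qed.

HB.instance Definition _ (F : fieldType) (l N : nat) (I : Type)
    (q : 'I_N -> I) (m : nat) (idx : I -> 'I_m -> 'I_l) :=
  GRing.isLinear.Build F 'rV[F]_l 'rV[F]_N _ (@helper_message F l N I q m idx)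
    (@helper_message_is_linear F l N I q m idx).

Lemma digit_code_repair (F : finFieldType) (n k m h q : nat)
    (lam : 'I_n -> nat -> F) (U : {vspace 'M[F]_(n, (m + h) * m.+1 ^ n)})
    (H R : {set 'I_n}) (beta : nat) :
  (forall (i i' : 'I_n) (j j' : nat), (j < m.+1)%N -> (j' < m.+1)%N ->
     lam i j = lam i' j' -> i = i' /\ j = j') ->
  (forall C, C \in U <-> @digit_code F n (n - k) m.+1 (m + h) lam C) ->
  #|H| = (h * q)%N -> (q * m + (n - #|R|) <= n - k)%N -> [disjoint H & R] ->
  beta = (h * m.+1 ^ n)%N ->
  exists (g : 'I_n -> 'rV[F]_((m + h) * m.+1 ^ n) -> 'rV[F]_beta)
         (rec : ('I_n -> 'rV[F]_beta) -> 'I_n -> 'rV[F]_((m + h) * m.+1 ^ n)),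
    forall C, C \in U -> forall i, i \in H ->
      rec (fun j => if j \in R then g j (row j C) else 0) i = row i C.
Proof.
move=> inj_lam inU cardH le_r disHR ->.
have [G [sGH cardG covG]] := set_split cardH.
have [enc encK digK] := digits_bij m n.
pose A := {ffun 'I_n -> 'I_m.+1}.
(* [unsplit] puts the shared blocks first and the block private to group g at m + g. *)
pose tau (a : A) (b : 'I_m + 'I_h) := tau_idx (m.+1 ^ n) (m + h) (enc a) (unsplit b).
(* One message symbol per pair (group, digit vector), which gives the value of beta. *)
have cardI : #|{: 'I_h * A}| = (h * m.+1 ^ n)%N by rewrite card_prod card_ffun !card_ord.
pose dec x := enum_val (cast_ord (esym cardI) x).
pose g := @helper_message F _ _ _ dec _ (fun (z : 'I_h * A) u => tau (shift (G z.1) u z.2) (block z.1 u)).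
have [|rec recP] := @linear_repair F n _ _ U H R g; last by exists (fun=> g), rec.
move=> C /inU codeC msg0 i iH; apply/rowP=> t; rewrite !mxE.
have [a [b ->]] := tau_idx_surj t; have [gi iG] := covG i iH.
rewrite -(encK a) -(splitK b).
(* Every node outside R counts as a non-helper, failed or not. *)
apply: (@centralized_repair F 'I_n m (n - k) h (fun i (j : 'I_m.+1) => lam i j)
  G (~: R) (fun i a b => C i (tau a b)) _ _ _ _ _ i gi) => //.
- by move=> j j' v v' /inj_lam[] // -> /val_inj.
- by move=> g'; apply: subset_trans (sGH g') _; rewrite -disjoints_subset.
- by move=> g'; rewrite cardG cardsCs setCK card_ord.
- move=> a' b' u ur; rewrite -[RHS](codeC (enc a') (unsplit b') u.+1) //.
  by apply: eq_bigr => j _; rewrite subn1 -digitsE digK.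
- move=> j g' a'; rewrite inE negbK => /msg0/rowP/(_ (cast_ord cardI (enum_rank (g', a')))).
  by rewrite !mxE /dec cast_ordK enum_rankK /= => msg_j; rewrite -[RHS]msg_j; apply: eq_bigr => u _; rewrite mxE.
Qed.

Theorem theorem3 (F : finFieldType) (n k h d : nat)
  (Hk : (1 <= k < n)%N) (Hh : (2 <= h <= n - k)%N) (Hd : (k < d <= n - h)%N)
  (lam : 'I_n -> nat -> F)
  (HF : (s0 k h d * n <= #|F|)%N)
  (Hlam : forall (i i' : 'I_n) (j j' : nat),
      (j < s0 k h d)%N -> (j' < s0 k h d)%N -> lam i j = lam i' j' ->
      i = i' /\ j = j') :
  is_MDS_array_code F n k (ell n k h d) (@inC3 F n k h d lam) /\
  optimal_repair F n k (ell n k h d) h d (@inC3 F n k h d lam).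
Proof.
have [/andP[_ lt_kn] /andP[h_gt1 _] /andP[lt_kd le_d]] := And3 Hk Hh Hd.
pose q := delta k h d; pose h' := (h %/ q)%N; pose m := ((d - k) %/ q)%N.
have q0 : (0 < q)%N by rewrite gcdn_gt0 (ltnW h_gt1).
have hE : h = (h' * q)%N by rewrite divnK ?dvdn_gcdl.
have mE : (d - k = m * q)%N by rewrite divnK ?dvdn_gcdr.
have s0E : s0 k h d = m.+1 by rewrite /s0 -/q mE -mulSnr mulnK.
have spE : sp k h d = (m + h')%N.
  by rewrite /sp -/q mE [in X in (_ + X)%N]hE -mulnDl mulnK.
have MDS : is_MDS_array_code F n k (ell n k h d) (@inC3 F n k h d lam).
  by apply: digit_code_MDS Hlam; rewrite ?s0E // ltnW.
split=> //; have [U [inU _]] := MDS => beta H R cardH cardR disHR.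
(* h l = (h' s0^n) ((m + h') q), and d - k + h = (m + h') q cancels. *)
have betaE : beta = (h' * m.+1 ^ n)%N.
  rewrite /beta mE [in X in (_ %/ X)%N]hE -mulnDl /ell s0E spE hE.
  rewrite (_ : (_ * _ * _ = (h' * m.+1 ^ n) * ((m + h') * q))%N); last first.
    by rewrite [((m + h') * _ ^ _)%N]mulnC mulnACA [(q * _)%N]mulnC.
  rewrite mulnK // muln_gt0 q0 andbT addn_gt0 orbC [(0 < h')%N]divn_gt0 //.
  by rewrite dvdn_leq ?dvdn_gcdl ?(ltnW h_gt1).
suff [g [rec recP]] : exists
    (g : 'I_n -> 'rV[F]_(ell n k h d) -> 'rV[F]_beta)
    (rec : ('I_n -> 'rV[F]_beta) -> 'I_n -> 'rV[F]_(ell n k h d)),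
    forall C, C \in U -> forall i, i \in H ->
      rec (fun j => if j \in R then g j (row j C) else 0) i = row i C.
  by exists g, rec => C /inU; apply: recP.
clear MDS HF; move: beta betaE; rewrite /inC3 /ell in U inU *.
(* The type of [U] depends on [s0] and [sp], so both are generalized before substitution. *)
move: (s0 k h d) (sp k h d) s0E spE U inU Hlam => p s -> -> U inU inj_lam beta.
apply: (digit_code_repair (k := k) (q := q) inj_lam inU) => //.
- by rewrite cardH.
(* Equality holds: q m + (n - d) = (d - k) + (n - d) = n - k. *)
- rewrite cardR mulnC -mE addnC addnBA ?(ltnW lt_kd) // subnK //.
  by apply: leq_trans le_d _; rewrite leq_subr.
Qed.
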